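(* Let $\mathbb{F}$ be an algebraically closed field of characteristic zero and let $G$ be a finite abelian group. Let $A$ be a regularly $G$-graded $\mathbb{F}$-algebra with commutation function $\theta$, and let $B,C$ be two $G$-graded $\mathbb{F}$-algebras. Then: 1. If $\theta\equiv 1$, then $Id_G(A\,\widehat{\otimes}\,B)=Id_G(B)$. 2. Let $\tilde A=A\,\widehat{\otimes}\cdots\widehat{\otimes}\,A$ be the envelope of $|G|-1$ copies of $A$. Then $\tilde A$ is regularly $G$-graded and $Id_G(\tilde A\,\widehat{\otimes}\,(A\,\widehat{\otimes}\,B))=Id_G(B)$. 3. $Id_G(B)=Id_G(C)$ if and only if $Id_G(A\,\widehat{\otimes}\,B)=Id_G(A\,\widehat{\otimes}\,C)$.
   Context: All algebras are associative over $\mathbb{F}$. A $G$-grading on $A$ is a vector space decomposition $A=\bigoplus_{g\in G}A_g$ with $A_gA_h\subseteq A_{gh}$. For $G$ finite abelian, a $G$-grading on $A$ is regular if there is a function $\theta:G\times G\to\mathbb{F}^\times$ (the commutation function) such that (i) for every $n\ge 1$ and $(g_1,\dots,g_n)\in G^n$ there are $a_i\in A_{g_i}$ with $a_1a_2\cdots a_n\neq 0$; (ii) for all $g,h\in G$, $a\in A_g$, $b\in A_h$: $ab=\theta(g,h)\,ba$. For $G$-graded algebras $A,B$, the $G$-envelope $A\,\widehat{\otimes}\,B$ is the $G$-graded subalgebra of $A\otimes_{\mathbb F} B$ with homogeneous components $(A\,\widehat{\otimes}\,B)_g=A_g\otimes B_g$. This operation is associative. (When $|G|=1$ the envelope of zero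 copies of $A$ is understood to be $\mathbb{F}$ with the trivial grading.) $\mathbb{F}\langle X_G\rangle$ is the free algebra on $X_G=\bigcup_{g\in G}X_g$, with $X_g$ a countably infinite set of noncommuting variables of degree $g$. $Id_G(W)$, for a $G$-graded algebra $W$, is the set of polynomials in $\mathbb{F}\langle X_G\rangle$ that vanish under every substitution replacing variables of $X_g$ by elements of $W_g$ (for all $g$). *)

(* Defs.v *)
From HB Require Import structures.
From mathcomp Require Import all_boot all_order all_algebra all_fingroup.
From mathcomp Require Import generic_quotient ring_quotient finmap.
From mathcomp Require Import boolp.
From mathcomp Require Import monalg.

Set Implicit Arguments.
Unset Strict Implicit.
Unset Printing Implicit Defensive.

Import GRing.Theory.

Local Open Scope ring_scope.

(* No unit is assumed, so an algebra is not even a pzRingType.                 *)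
Record assocAlg (F : fieldType) := AssocAlg {
  alg_space :> lmodType F;
  amul : alg_space -> alg_space -> alg_space;
  amulA : associative amul;
  amul_linl : forall y, linear (amul^~ y);
  amul_linr : forall x, linear (amul x)
}.

Arguments amul {F _} _ _.

Definition is_unit_elt (F : fieldType) (W : assocAlg F) (e : W) : Prop :=
  left_id e amul /\ right_id e amul.

(* The product of a nonempty sequence; the value on [::] is a dummy.           *)
Definition aprod (F : fieldType) (W : assocAlg F) (s : seq W) : W :=
  if s is x :: s' then foldl amul x s' else 0.

Record gradedAlg (F : fieldType) (G : finGroupType) := GradedAlg {
  gr_alg :> assocAlg F;
  gcomp : G -> {pred gr_alg};
  gcomp_submod : forall g, submod_closed (gcomp g);
  gcomp_span : forall x : gr_alg, exists f : G -> gr_alg,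
    (forall g, f g \in gcomp g) /\ x = \sum_g f g;
  gcomp_direct : forall f : G -> gr_alg,
    (forall g, f g \in gcomp g) -> \sum_g f g = 0 -> forall g, f g = 0;
  gcomp_mul : forall g h (a b : gr_alg),
    a \in gcomp g -> b \in gcomp h -> amul a b \in gcomp (g * h)%g
}.

Arguments gcomp {F G} _ _.

Section Regular.
Variables (F : fieldType) (G : finGroupType).

Definition regular_with (theta : G -> G -> F) (A : gradedAlg F G) : Prop :=
  [/\ forall g h, theta g h != 0,
      forall (n : nat) (g : 'I_n.+1 -> G), exists a : 'I_n.+1 -> A,
        (forall i, a i \in gcomp A (g i)) /\ aprod (codom a) <> 0
    & forall g h (a b : A), a \in gcomp A g -> b \in gcomp A h ->
        amul a b = theta g h *: amul b a].

Definition regularly_graded (A : gradedAlg F G) : Prop :=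
  exists theta : G -> G -> F, regular_with theta A.

End Regular.

Section LinearAux.
Variable F : fieldType.

Lemma linear_0 (U V : lmodType F) (f : U -> V) : linear f -> f 0 = 0.
Proof.
by move=> fL; have := fL (-1) 0 0; rewrite scaler0 addr0 scaleN1r addNr.
Qed.

Lemma linear_D (U V : lmodType F) (f : U -> V) :
  linear f -> forall x y, f (x + y) = f x + f y.
Proof. by move=> fL x y; have := fL 1 x y; rewrite !scale1r. Qed.

Lemma linear_sum (U V : lmodType F) (f : U -> V) (I : Type) (r : seq I)
    (E : I -> U) : linear f -> f (\sum_(i <- r) E i) = \sum_(i <- r) f (E i).
Proof.
move=> fL; elim: r => [|i r IHr]; first by rewrite !big_nil linear_0.
by rewrite !big_cons -IHr linear_D.
Qed.

Lemma linear_Z (U V : lmodType F) (f : U -> V) :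
  linear f -> forall c x, f (c *: x) = c *: f x.
Proof. by move=> fL c x; rewrite -[c *: x]addr0 fL linear_0 // addr0. Qed.

End LinearAux.

Section TensorSpace.
Variables (F : fieldType) (A B : lmodType F).

Local Notation free := {malg F[(A * B)%type]}.

(* The subspace spanned by the bilinearity relations; A (x) B is the quotient. *)
Inductive tensor_null : free -> Prop :=
| TensorNull0 : tensor_null 0
| TensorNullP c x y :
    tensor_null x -> tensor_null y -> tensor_null (c *: x + y)
| TensorNullL c a a' b :
    tensor_null (<< (c *: a + a', b) >> - (c *: << (a, b) >> + << (a', b) >>))
| TensorNullR c a b b' :
    tensor_null (<< (a, c *: b + b') >> - (c *: << (a, b) >> + << (a, b') >>)).

Definition tensor_nullb : {pred free} := fun x => `[< tensor_null x >].

Fact tensor_nullb_submod : submod_closed tensor_nullb.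
Proof.
split=> [|c x y /asboolP xN /asboolP yN]; apply/asboolP.
  exact: TensorNull0.
exact: TensorNullP.
Qed.

HB.instance Definition _ :=
  GRing.isSubmodClosed.Build F free tensor_nullb tensor_nullb_submod.

Definition tensor : Type := Quotient.quot tensor_nullb.
HB.instance Definition _ := GRing.Zmodule.on tensor.
HB.instance Definition _ := Quotient.on tensor.

Local Open Scope quotient_scope.
Local Notation pit := (\pi_tensor).

Lemma pitP (x y : free) : reflect (tensor_null (x - y)) (pit x == pit y).
Proof. by rewrite -[_ == _]Quotient.idealrBE; apply: asboolP. Qed.

Lemma pitD (x y : free) : pit (x + y) = pit x + pit y.
Proof. exact: (@Quotient.pi_add _ tensor_nullb). Qed.

Definition tensor_scale (c : F) (t : tensor) : tensor := pit (c *: repr t).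

Lemma pitZ c (x : free) : pit (c *: x) = tensor_scale c (pit x).
Proof.
apply/eqP/pitP; rewrite -scalerBr -[_ *: _]addr0.
apply: TensorNullP; last exact: TensorNull0.
by apply/pitP; rewrite reprK.
Qed.

Fact tensor_scaleA c d t :
  tensor_scale c (tensor_scale d t) = tensor_scale (c * d) t.
Proof. by rewrite -[t]reprK -(pitZ d) -(pitZ c) -pitZ scalerA. Qed.

Fact tensor_scale1 : left_id 1 tensor_scale.
Proof. by move=> t; rewrite -[t in LHS]reprK -pitZ scale1r reprK. Qed.

Fact tensor_scaleDr : right_distributive tensor_scale +%R.
Proof.
by move=> c t u; rewrite -[t]reprK -[u]reprK -pitD -!pitZ -pitD scalerDr.
Qed.

Fact tensor_scaleDl t : {morph tensor_scale^~ t : c d / c + d}.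
Proof. by move=> c d /=; rewrite -[t]reprK -!pitZ -pitD scalerDl. Qed.

HB.instance Definition _ := GRing.Zmodule_isLmodule.Build F tensor
  tensor_scaleA tensor_scale1 tensor_scaleDr tensor_scaleDl.

Lemma pit_scale c (x : free) : pit (c *: x) = c *: pit x.
Proof. exact: pitZ. Qed.

Lemma pit_sum (I : Type) (r : seq I) (E : I -> free) :
  pit (\sum_(i <- r) E i) = \sum_(i <- r) pit (E i).
Proof.
elim: r => [|i r IHr]; last by rewrite !big_cons pitD IHr.
by rewrite !big_nil; apply: (addrI (pit 0)); rewrite -pitD !addr0.
Qed.

End TensorSpace.

HB.lock Definition tens (F : fieldType) (A B : lmodType F) (a : A) (b : B) :
  tensor A B := (\pi_(tensor A B) << (a, b) >>)%qT.
Arguments tens {F A B} a b.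

(* The linear extension to {malg F[A * B]} of a map f on A * B, and the linear *)
(* map that f induces on the tensor product when it is bilinear.               *)
Definition free_ext (F : fieldType) (A B V : lmodType F) (f : A -> B -> V)
  (x : {malg F[(A * B)%type]}) : V := \sum_(k <- msupp x) x@_k *: f k.1 k.2.

HB.lock Definition tensor_lift (F : fieldType) (A B V : lmodType F)
  (f : A -> B -> V) (t : tensor A B) : V := free_ext f (repr t).
Arguments tensor_lift {F A B V} f t.

Section TensorTheory.
Variables (F : fieldType) (A B : lmodType F).

Local Notation free := {malg F[(A * B)%type]}.
Local Notation tensor := (tensor A B).

Local Open Scope quotient_scope.
Local Notation pit := (\pi_tensor).

Lemma tens_linl b : linear (tens^~ b : A -> tensor).
Proof.
move=> c a a'; rewrite tens.unlock -pit_scale -pitD; apply/eqP/pitP.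
exact: TensorNullL.
Qed.

Lemma tens_linr a : linear (tens a : B -> tensor).
Proof.
move=> c b b'; rewrite tens.unlock -pit_scale -pitD; apply/eqP/pitP.
exact: TensorNullR.
Qed.

Lemma tensorE (t : tensor) : exists s : seq (A * B),
  t = \sum_(k <- s) tens k.1 k.2.
Proof.
pose x := repr t; exists [seq (x@_k *: k.1, k.2) | k <- msupp x].
rewrite -[t in LHS]reprK -/x [x in LHS]monalgE pit_sum big_map.
apply: eq_bigr => -[a b] _ /=.
have -> : << x@_(a, b) *g (a, b) >> = x@_(a, b) *: << (a, b) >> :> free.
  by apply/malgP=> k; rewrite mcoeffZ !mcoeffU mulr_natr.
by rewrite (linear_Z (tens_linl b)) pit_scale tens.unlock.
Qed.

Lemma tensor_ind (P : tensor -> Prop) :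
    P 0 -> (forall a b, P (tens a b)) ->
    (forall t u, P t -> P u -> P (t + u)) -> forall t, P t.
Proof.
by move=> P0 Pt PD t; have [s ->] := tensorE t; apply: big_ind => // k _.
Qed.

Section Lift.
Variables (V : lmodType F) (f : A -> B -> V).

Lemma free_extEw (d : {fset (A * B)%type}) (x : free) :
  (msupp x `<=` d)%fset -> free_ext f x = \sum_(k <- d) x@_k *: f k.1 k.2.
Proof.
move=> le; rewrite /free_ext (big_fset_incl _ le) //= => k _ /mcoeff_outdom ->.
by rewrite scale0r.
Qed.

Lemma free_ext_lin : linear (free_ext f).
Proof.
move=> c x y.
pose d := (msupp x `|` msupp y)%fset.
have lex : (msupp x `<=` d)%fset by apply: fsubsetUl.
have ley : (msupp y `<=` d)%fset by apply: fsubsetUr.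
have lexy : (msupp (c *: x + y)%R `<=` d)%fset.
  apply: fsubset_trans (msuppD_le _ _) _; apply: fsetSU; exact: msuppZ_le.
rewrite (free_extEw lex) (free_extEw ley) (free_extEw lexy).
rewrite scaler_sumr -big_split /=; apply: eq_bigr => k _.
by rewrite mcoeffD mcoeffZ scalerDl scalerA.
Qed.

Lemma free_ext0 : free_ext f 0 = 0.
Proof. by rewrite /free_ext msupp0 big_seq_fset0. Qed.

Lemma free_extB x y : free_ext f (x - y) = free_ext f x - free_ext f y.
Proof.
have := free_ext_lin (-1) y x.
by rewrite !scaleN1r [- y + x]addrC => ->; rewrite addrC.
Qed.

Lemma free_extU k : free_ext f << k >> = f k.1 k.2.
Proof. by rewrite /free_ext msuppU oner_eq0 big_seq_fset1 mcoeffUU scale1r. Qed.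

Hypotheses (fl : forall b, linear (f^~ b)) (fr : forall a, linear (f a)).

Lemma free_ext_null x : tensor_null x -> free_ext f x = 0.
Proof.
elim=> [|c y z _ Hy _ Hz|c a a' b|c a b b'].
- exact: free_ext0.
- by rewrite free_ext_lin Hy Hz scaler0 addr0.
- by rewrite free_extB free_ext_lin !free_extU /= [X in X - _]fl subrr.
- by rewrite free_extB free_ext_lin !free_extU /= [X in X - _]fr subrr.
Qed.

Lemma tensor_lift_pi x : tensor_lift f (pit x) = free_ext f x.
Proof.
rewrite tensor_lift.unlock; apply/eqP; rewrite -subr_eq0 -free_extB.
apply/eqP/free_ext_null.
by apply/pitP; rewrite reprK.
Qed.

Lemma tensor_lift_lin : linear (tensor_lift f).
Proof.
move=> c t u; rewrite -[t]reprK -[u]reprK -pit_scale -pitD.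
by rewrite !tensor_lift_pi free_ext_lin.
Qed.

Lemma tensor_lift_tens a b : tensor_lift f (tens a b) = f a b.
Proof. by rewrite tens.unlock tensor_lift_pi free_extU. Qed.

End Lift.

Lemma tensor_lift_linf (V : lmodType F) (h f g : A -> B -> V) c t :
  (forall a b, h a b = c *: f a b + g a b) ->
  tensor_lift h t = c *: tensor_lift f t + tensor_lift g t.
Proof.
move=> hE; rewrite tensor_lift.unlock /free_ext scaler_sumr -big_split /=.
by apply: eq_bigr => k _; rewrite hE scalerDr !scalerA [_ * c]mulrC.
Qed.

End TensorTheory.

(* The product with (a (x) b) (a' (x) b') = a a' (x) b b'.                      *)
HB.lock Definition tensor_mul (F : fieldType) (A B : assocAlg F)
    (t u : tensor A B) : tensor A B :=
  tensor_lift (fun a b =>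
    tensor_lift (fun a' b' => tens (amul a a') (amul b b')) u) t.
Arguments tensor_mul {F A B} t u.

Section TensorAlgebra.
Variables (F : fieldType) (A B : assocAlg F).
Local Notation tensor_mul := (@tensor_mul F A B).

Let fl a b b' :
  linear ((fun a' b' => tens (amul a a') (amul b b') : tensor A B)^~ b').
Proof. by move=> c x y; rewrite (amul_linr a) tens_linl. Qed.

Let fr a b a' :
  linear (fun b' => tens (amul a a') (amul b b') : tensor A B).
Proof. by move=> c x y; rewrite (amul_linr b) tens_linr. Qed.

Let gl u b : linear (fun a =>
  tensor_lift (fun a' b' => tens (amul a a') (amul b b') : tensor A B) u).
Proof.
move=> c x y; apply: tensor_lift_linf => a' b'.
by rewrite (amul_linl a') tens_linl.
Qed.

Let gr u a : linear (fun b =>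
  tensor_lift (fun a' b' => tens (amul a a') (amul b b') : tensor A B) u).
Proof.
move=> c x y; apply: tensor_lift_linf => a' b'.
by rewrite (amul_linl b') tens_linr.
Qed.

Fact tensor_mul_linl u : linear (tensor_mul^~ u).
Proof. rewrite tensor_mul.unlock; exact: (tensor_lift_lin (gl u) (gr u)). Qed.

Fact tensor_mul_linr t : linear (tensor_mul t).
Proof.
rewrite tensor_mul.unlock => c u v; apply: tensor_lift_linf => a b.
exact: (tensor_lift_lin (fl a b) (fr a b)).
Qed.

Lemma tensor_mul_tens a b a' b' :
  tensor_mul (tens a b) (tens a' b') = tens (amul a a') (amul b b').
Proof.
by rewrite tensor_mul.unlock (tensor_lift_tens (gl _) (gr _))
  (tensor_lift_tens (fl a b) (fr a b)).
Qed.

Lemma tensor_mul_sum (I J : Type) (r : seq I) (s : seq J) E E' :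
  tensor_mul (\sum_(i <- r) E i) (\sum_(j <- s) E' j) =
    \sum_(i <- r) \sum_(j <- s) tensor_mul (E i) (E' j).
Proof.
rewrite (linear_sum _ _ (tensor_mul_linl _)); apply: eq_bigr => i _.
exact: (linear_sum _ _ (tensor_mul_linr _)).
Qed.

Lemma tensor_mul0l t : tensor_mul 0 t = 0.
Proof. exact: (linear_0 (tensor_mul_linl t)). Qed.

Lemma tensor_mul0r t : tensor_mul t 0 = 0.
Proof. exact: (linear_0 (tensor_mul_linr t)). Qed.

Lemma tensor_mulDl t u v :
  tensor_mul (t + u) v = tensor_mul t v + tensor_mul u v.
Proof. exact: (linear_D (tensor_mul_linl v)). Qed.

Lemma tensor_mulDr t u v :
  tensor_mul t (u + v) = tensor_mul t u + tensor_mul t v.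
Proof. exact: (linear_D (tensor_mul_linr t)). Qed.

Fact tensor_mulA : associative tensor_mul.
Proof.
move=> t u v; elim/tensor_ind: t => [|a b|t t' IHt IHt'].
- by rewrite !tensor_mul0l.
- elim/tensor_ind: u => [|a' b'|u u' IHu IHu'].
  + by rewrite tensor_mul0r !tensor_mul0l tensor_mul0r.
  + elim/tensor_ind: v => [|a'' b''|v v' IHv IHv'].
    * by rewrite !tensor_mul0r.
    * by rewrite !tensor_mul_tens !amulA.
    * by rewrite !tensor_mulDr IHv IHv'.
  + by rewrite tensor_mulDl !tensor_mulDr tensor_mulDl IHu IHu'.
- by rewrite !tensor_mulDl IHt IHt'.
Qed.

Definition tensor_alg : assocAlg F :=
  AssocAlg tensor_mulA tensor_mul_linl tensor_mul_linr.

End TensorAlgebra.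

Section Envelope.
Variables (F : fieldType) (G : finGroupType) (A B : gradedAlg F G).

(* The subspace A_g (x) B_g of A (x) B.                                        *)
Definition tensor_comp (g : G) : {pred tensor A B} := fun t =>
  `[< exists s : seq (A * B),
        all (fun k => (k.1 \in gcomp A g) && (k.2 \in gcomp B g)) s /\
        t = \sum_(k <- s) tens k.1 k.2 >].

Definition envelope_pred : {pred tensor A B} := fun t =>
  `[< exists f : G -> tensor A B,
        (forall g, f g \in tensor_comp g) /\ t = \sum_g f g >].

Lemma tensor_comp_submod g : submod_closed (tensor_comp g).
Proof.
split=> [|c t u]; first by apply/asboolP; exists [::]; rewrite big_nil.
move=> /asboolP[r [rP ->]] /asboolP[s [sP ->]]; apply/asboolP.
exists ([seq (c *: k.1, k.2) | k <- r] ++ s); split.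
  rewrite all_cat sP andbT all_map; apply: sub_all rP => k /= /andP[k1 ->].
  have [A0 AP] := gcomp_submod A g.
  by rewrite andbT -[_ *: _]addr0 AP.
rewrite big_cat big_map; congr (_ + _); rewrite scaler_sumr.
by apply: eq_bigr => k _; rewrite (linear_Z (tens_linl k.2)).
Qed.

Fact envelope_submod : submod_closed envelope_pred.
Proof.
split=> [|c t u].
  apply/asboolP; exists (fun=> 0); split; last by rewrite big1.
  by move=> g; have [] := tensor_comp_submod g.
move=> /asboolP[f [fP ->]] /asboolP[h [hP ->]]; apply/asboolP.
exists (fun g => c *: f g + h g); split=> [g|].
  by have [_] := tensor_comp_submod g; apply.
by rewrite scaler_sumr -big_split.
Qed.

HB.instance Definition _ :=
  GRing.isSubmodClosed.Build F (tensor A B) envelope_pred envelope_submod.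

Lemma tensor_comp_env g t : t \in tensor_comp g -> t \in envelope_pred.
Proof.
move=> tP; apply/asboolP; exists (fun h => if h == g then t else 0); split.
  move=> h; case: eqP => [->//|_]; by have [] := tensor_comp_submod h.
by rewrite -big_mkcond big_pred1_eq.
Qed.

Lemma tensor_comp_mul g h (t u : tensor_alg A B) :
  t \in tensor_comp g -> u \in tensor_comp h ->
  amul t u \in tensor_comp (g * h)%g.
Proof.
move=> /asboolP[r [rP ->]] /asboolP[s [sP ->]]; apply/asboolP.
exists [seq (amul i.1 j.1, amul i.2 j.2) | i <- r, j <- s]; split.
  apply/allP=> _ /allpairsP[[i j] /= [ir js ->]] /=.
  have /andP[i1 i2] := allP rP _ ir; have /andP[j1 j2] := allP sP _ js.
  by rewrite !gcomp_mul.
rewrite big_flatten big_map /= tensor_mul_sum.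
apply: eq_bigr => i _; rewrite big_map.
by apply: eq_bigr => j _; rewrite tensor_mul_tens.
Qed.

Fact envelope_mul (t u : tensor_alg A B) :
  t \in envelope_pred -> u \in envelope_pred -> amul t u \in envelope_pred.
Proof.
move=> /asboolP[f [fP ->]] /asboolP[h [hP ->]].
rewrite -[amul _ _]/(tensor_mul _ _) tensor_mul_sum; do 2!apply: rpred_sum => ? _.
by apply: tensor_comp_env; apply: tensor_comp_mul.
Qed.

Record envelope_space := EnvelopeElt {
  env_val :> tensor A B;
  env_valP : env_val \in envelope_pred
}.

HB.instance Definition _ := [isSub for env_val].
HB.instance Definition _ := [Choice of envelope_space by <:].
HB.instance Definition _ := [SubChoice_isSubLmodule of envelope_space by <:].

Definition env_mul (x y : envelope_space) : envelope_space :=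
  EnvelopeElt (envelope_mul (env_valP x) (env_valP y)).

Fact env_mulA : associative env_mul.
Proof. by move=> x y z; apply/val_inj/(@amulA _ (tensor_alg A B)). Qed.

Fact env_mul_linl y : linear (env_mul^~ y).
Proof. by move=> c x z; apply/val_inj/(@amul_linl _ (tensor_alg A B)). Qed.

Fact env_mul_linr x : linear (env_mul x).
Proof. by move=> c y z; apply/val_inj/(@amul_linr _ (tensor_alg A B)). Qed.

Definition envelope_alg : assocAlg F :=
  AssocAlg env_mulA env_mul_linl env_mul_linr.

Definition env_comp (g : G) : {pred envelope_alg} :=
  fun x => env_val x \in tensor_comp g.

Fact env_comp_submod g : submod_closed (env_comp g).
Proof.
have [t0 tP] := tensor_comp_submod g.
by split=> [|c x y xP yP]; [apply: t0|apply: (tP c)].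
Qed.

Lemma env_val_sum (E : G -> envelope_alg) :
  env_val (\sum_g E g) = \sum_g env_val (E g).
Proof. exact: (raddf_sum val). Qed.

Fact env_comp_span (x : envelope_alg) : exists f : G -> envelope_alg,
  (forall g, f g \in env_comp g) /\ x = \sum_g f g.
Proof.
case: x => t tP; have /asboolP[f [fP tE]] := tP.
exists (fun g => EnvelopeElt (tensor_comp_env (fP g))); split=> [g|].
  exact: fP.
by apply: val_inj; rewrite /= env_val_sum.
Qed.

Definition gr_proj (g : G) (a : A) : A := projT1 (cid (gcomp_span a)) g.

Lemma gr_projE (f : G -> A) a : (forall g, f g \in gcomp A g) ->
  a = \sum_g f g -> forall g, gr_proj g a = f g.
Proof.
move=> fP aE g; rewrite /gr_proj; case: cid => /= h [hP ahE].
apply/eqP; rewrite -subr_eq0; apply/eqP.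
apply: (@gcomp_direct _ _ A (fun g => h g - f g)) => [k|].
  have /GRing.submod_closedB[_ sP] := gcomp_submod A k; exact: sP.
by rewrite sumrB -ahE -aE subrr.
Qed.

Lemma gr_proj_lin g : linear (gr_proj g).
Proof.
move=> c a b; rewrite [gr_proj _ a]/gr_proj [gr_proj _ b]/gr_proj.
case: cid => /= f [fP aE]; case: cid => /= h [hP bE].
apply: (@gr_projE (fun g => c *: f g + h g)) => [k|].
  by have [_] := gcomp_submod A k; apply.
by rewrite [in LHS]aE [in LHS]bE scaler_sumr -big_split.
Qed.

Lemma gr_proj_comp g h a : a \in gcomp A h ->
  gr_proj g a = if g == h then a else 0.
Proof.
move=> aP; apply: (@gr_projE (fun g => if g == h then a else 0)) => [k|].
  by case: eqP => [->//|_]; have [] := gcomp_submod A k.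
by rewrite -big_mkcond big_pred1_eq.
Qed.

Lemma tensor_comp_direct (f : G -> tensor A B) :
  (forall g, f g \in tensor_comp g) -> \sum_g f g = 0 -> forall g, f g = 0.
Proof.
move=> fP f0 g.
pose P := tensor_lift (fun (a : A) (b : B) => tens (gr_proj g a) b).
have Pl b : linear (fun a => tens (gr_proj g a) b : tensor A B).
  by move=> c x y; rewrite gr_proj_lin tens_linl.
have Pr a : linear (fun b => tens (gr_proj g a) b : tensor A B).
  by move=> c x y; rewrite tens_linr.
have PL : linear P by apply: tensor_lift_lin.
have Pt a b : P (tens a b) = tens (gr_proj g a) b.
  exact: (tensor_lift_tens Pl Pr).
have PE h : P (f h) = if h == g then f h else 0.
  have /asboolP[s [sP ->]] := fP h.
  rewrite (linear_sum _ _ PL); case: (h =P g) => [hg|hNg].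
    apply: eq_big_seq => k ks; have /andP[k1 _] := allP sP _ ks.
    by rewrite Pt (gr_proj_comp g k1) hg eqxx.
  rewrite big_seq big1 // => k ks; have /andP[k1 _] := allP sP _ ks.
  rewrite Pt (gr_proj_comp g k1); case: eqP => [/esym //|_].
  exact: (linear_0 (tens_linl k.2)).
have := linear_0 PL; rewrite -f0 (linear_sum _ _ PL).
rewrite (eq_bigr (fun h => if h == g then f h else 0)) => [|h _]; last exact: PE.
by rewrite -big_mkcond big_pred1_eq f0.
Qed.

Fact env_comp_direct (f : G -> envelope_alg) :
  (forall g, f g \in env_comp g) -> \sum_g f g = 0 -> forall g, f g = 0.
Proof.
move=> fP f0 g; apply: val_inj.
apply: (@tensor_comp_direct (fun g => env_val (f g))) => //.
by rewrite -env_val_sum f0.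
Qed.

Fact env_comp_mul g h (x y : envelope_alg) :
  x \in env_comp g -> y \in env_comp h -> amul x y \in env_comp (g * h)%g.
Proof. exact: tensor_comp_mul. Qed.

Definition envelope : gradedAlg F G := GradedAlg env_comp_submod
  env_comp_span env_comp_direct env_comp_mul.

End Envelope.

Section BaseField.
Variables (F : fieldType) (G : finGroupType).

Fact base_mul_linl (y : F^o) : linear (fun x : F^o => x * y : F^o).
Proof. by move=> c x z; rewrite mulrDl -scalerAl. Qed.

Fact base_mul_linr (x : F^o) : linear (fun y : F^o => x * y : F^o).
Proof. by move=> c y z; rewrite mulrDr -scalerAr. Qed.

Definition base_alg : assocAlg F :=
  @AssocAlg F F^o *%R (@mulrA F) base_mul_linl base_mul_linr.

Definition base_comp (g : G) : {pred base_alg} :=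
  fun x => (g == 1%g) || (x == 0).

Fact base_compE g x : (x \in base_comp g) = (g == 1%g) || (x == 0).
Proof. by []. Qed.

Fact base_comp_submod g : submod_closed (base_comp g).
Proof.
split=> [|c x y]; rewrite !base_compE; first by rewrite eqxx orbT.
by case: (g == 1%g) => //= /eqP-> /eqP->; rewrite scaler0 addr0.
Qed.

Fact base_comp_span (x : base_alg) : exists f : G -> base_alg,
  (forall g, f g \in base_comp g) /\ x = \sum_g f g.
Proof.
exists (fun g => if g == 1%g then x else 0); split=> [g|].
  by rewrite base_compE; case: (g == 1%g) => //=.
by rewrite -big_mkcond big_pred1_eq.
Qed.

Fact base_comp_direct (f : G -> base_alg) :
  (forall g, f g \in base_comp g) -> \sum_g f g = 0 -> forall g, f g = 0.
Proof.
move=> fP; have f0 g : g != 1%g -> f g = 0.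
  by move=> /negPf gN1; have := fP g; rewrite base_compE gN1 => /eqP.
rewrite (bigD1 1%g) //= big1 ?addr0 // => f1 g.
by have [->//|/f0] := eqVneq g 1%g.
Qed.

Fact base_comp_mul g h (x y : base_alg) :
  x \in base_comp g -> y \in base_comp h -> amul x y \in base_comp (g * h)%g.
Proof.
rewrite !base_compE -[amul x y]/(x * y : F).
move=> /orP[/eqP->|/eqP-> _]; last by rewrite mul0r eqxx orbT.
by move=> /orP[/eqP->|/eqP->]; rewrite ?mulg1 ?mulr0 eqxx ?orbT.
Qed.

Definition base_graded : gradedAlg F G := GradedAlg base_comp_submod
  base_comp_span base_comp_direct base_comp_mul.

End BaseField.

(* Bracketed to the right; the empty power is F, trivially graded.             *)
Fixpoint envelope_power (F : fieldType) (G : finGroupType)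
    (A : gradedAlg F G) (n : nat) : gradedAlg F G :=
  match n with
  | 0 => base_graded F G
  | 1 => A
  | m.+1 => envelope A (envelope_power A m)
  end.

(* The variable (g, i) is the i-th variable of degree g.                       *)
Notation gvar G := (FinGroup.sort G * nat)%type.
Notation free_alg F G := {malg F[{fmonom gvar G}]}.

Section Identities.
Variables (F : fieldType) (G : finGroupType) (W : gradedAlg F G).

Definition graded_subst (s : gvar G -> W) : Prop :=
  forall x : gvar G, s x \in gcomp W x.1.

(* The value at s of p without its constant term: the empty word contributes 0. *)
Definition eval_nonconst (s : gvar G -> W) (p : free_alg F G) : W :=
  \sum_(m <- msupp p) p@_m *: aprod [seq s x | x <- (m : seq (gvar G))].

(* p vanishes at s. The constant term c of p takes the value c *: e if W has   *)
(* a unit e; in an algebra without unit it lives in the adjoined copy of F,    *)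
(* so that it has to be 0.                                                     *)
Definition vanishes_at (s : gvar G -> W) (p : free_alg F G) : Prop :=
  (exists e : W, is_unit_elt e /\ p@_(@mone _) *: e + eval_nonconst s p = 0) \/
  (p@_(@mone _) = 0 /\ eval_nonconst s p = 0).

Definition Id_G (p : free_alg F G) : Prop :=
  forall s : gvar G -> W, graded_subst s -> vanishes_at s p.

End Identities.

(* Main.v *)
Require Import Defs.
From mathcomp Require Import all_boot all_order all_algebra all_fingroup.
From mathcomp Require Import finmap boolp classical_sets.
From mathcomp Require Import monalg.

(** In characteristic zero the graded identities of an algebra are determined by
    the multilinear ones, and on multilinear polynomials the envelope with a
    regularly graded algebra acts by an invertible diagonal rescaling of the
    coefficients.

    Fix degrees g_0, .., g_(n-1) and read a function c on the symmetric group
    as the multilinear polynomial whose coefficient at the word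
    x_(s 0) .. x_(s (n-1)) is c s.  If A is regularly graded with commutation
    function theta, then for homogeneous a_i of degree g_i the product of the
    a_(s i) is tau_theta s times the product of the a_i, where tau_theta s is
    the product of the theta (g, h) over the adjacent swaps that sort the word
    ([aprod_reorder]).  Evaluating c on pure tensors a_i (x) b_i therefore gives
    (a_0 .. a_(n-1)) (x) (value of tau_theta * c on the b_i), and since
    the a_i can be chosen with nonzero product, c is an identity of the envelope
    of A and B exactly when tau_theta * c is one of B
    ([mlin_identity_envelope]).

    The list of swaps depends on s and on the degrees only, so tau is
    multiplicative in theta.  All three claims follow.  When theta = 1 nothing
    is rescaled.  The envelope of |G| - 1 copies of A has commutation function
    theta ^ (|G| - 1), and theta ^ |G| = 1 because theta is a bicharacter, so the
    two rescalings in the second claim cancel.  Finally tau_theta has no zero, so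
    the rescaling is a bijection on multilinear polynomials, which gives both
    directions of the third claim.

    The passage to multilinear polynomials is [eval_nonconst_eq0P].  A polynomial
    is recovered from its full polarizations by averaging over the symmetric
    group, which needs n! to be invertible; conversely a polarization is the part
    of degree (1, .., 1) in t of the value at sum_i t_i y_i, and that part is
    isolated by a Vandermonde argument.

    A constant term has to be treated apart: it can only occur in an identity
    of the zero algebra.  Hence ideals of identities are compared in
    [Id_G_eqP] through multilinear identities and through being zero. *)

Set Implicit Arguments.
Unset Strict Implicit.
Unset Printing Implicit Defensive.

Import GRing.Theory.

Local Open Scope ring_scope.

(** * Products of words in a nonunital algebra *)

Lemma linear_sum_cond (F : fieldType) (U V : lmodType F) (f : U -> V)
    (I : Type) (r : seq I) (P : pred I) (E : I -> U) : linear f ->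
  f (\sum_(i <- r | P i) E i) = \sum_(i <- r | P i) f (E i).
Proof. by move=> fL; apply: big_morph; [apply: linear_D|apply: linear_0]. Qed.

Section Words.
Variables (F : fieldType) (W : assocAlg F).
Implicit Types (x y z : W) (s : seq W).

Lemma amul0l y : amul 0 y = 0 :> W.
Proof. exact: (linear_0 (amul_linl y)). Qed.

Lemma amulZl c x y : amul (c *: x) y = c *: amul x y.
Proof. exact: (linear_Z (amul_linl y)). Qed.

Lemma amulZr c x y : amul x (c *: y) = c *: amul x y.
Proof. exact: (linear_Z (amul_linr x)). Qed.

Lemma foldl_amul_linear s : linear (fun x => foldl amul x s).
Proof.
elim: s => [|z s IHs] c x y //=.
by rewrite -IHs amul_linl.
Qed.

Lemma foldl_amulZ c x s : foldl amul (c *: x) s = c *: foldl amul x s.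
Proof. exact: (linear_Z (foldl_amul_linear s)). Qed.

Lemma aprodZ (I : Type) (t : I -> F) (y : I -> W) (k : seq I) :
  aprod [seq t i *: y i | i <- k] = (\prod_(i <- k) t i) *: aprod (map y k).
Proof.
case: k => [|i k] /=; first by rewrite scaler0.
rewrite big_cons foldl_amulZ -scalerA; congr (_ *: _).
elim: k (y i) => [|j k IHk] x /=; first by rewrite big_nil scale1r.
by rewrite amulZr foldl_amulZ IHk big_cons scalerA.
Qed.

Lemma sum_cons_tuple (V : nmodType) (I : finType) n (P : pred (seq I))
    (E : seq I -> V) :
  \sum_(k : n.+1.-tuple I | P k) E k =
    \sum_(i : I) \sum_(k : n.-tuple I | P (i :: k)) E (i :: k).
Proof.
rewrite pair_big_dep /=.
rewrite (reindex (fun ik : I * n.-tuple I => [tuple of ik.1 :: ik.2])) //=.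
exists (fun k : n.+1.-tuple I => (thead k, [tuple of behead k])) => [[i k] _|k _].
  by rewrite /= theadE; congr (_, _); apply: val_inj.
by rewrite /= -tuple_eta.
Qed.

(** Substituting for each letter v of m the sum of the y i over the i labelled
    v, and expanding, amounts to choosing a label for every position of m.  The
    running product x is what makes the induction go through without a unit. *)
Lemma foldl_sum_letters (X : eqType) (I : finType) (u : I -> X) (y : I -> W)
    (m : seq X) x :
  foldl amul x [seq \sum_(i | u i == v) y i | v <- m] =
    \sum_(k : (size m).-tuple I | map u k == m) foldl amul x (map y k).
Proof.
elim: m x => [|v m IHm] x /=.
  rewrite (eq_bigr (fun=> x)) => [|k _]; last by rewrite (tuple0 k).
  rewrite (eq_bigl xpredT) => [|k]; last by rewrite (tuple0 k).
  by rewrite big_const card_tuple expn0 /= addr0.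
rewrite IHm (sum_cons_tuple _ (fun k => map u k == v :: m)
  (fun k => foldl amul x (map y k))).
have expand (k : (size m).-tuple I) :
    foldl amul (amul x (\sum_(i | u i == v) y i)) (map y k) =
    \sum_(i | u i == v) foldl amul (amul x (y i)) (map y k).
  rewrite (linear_sum_cond _ _ _ (amul_linr x)).
  by rewrite (linear_sum_cond _ _ _ (foldl_amul_linear _)).
transitivity (\sum_(k : (size m).-tuple I | map u k == m)
    \sum_(i | u i == v) foldl amul (amul x (y i)) (map y k)).
  by apply: eq_bigr => k _; exact: expand.
rewrite exchange_big /= big_mkcond /=; apply: eq_bigr => i _.
case: (u i =P v) => [->|/eqP/negPf uiNz].
  by apply: eq_bigl => k; rewrite eqseq_cons eqxx.
by rewrite big_pred0 // => k; rewrite eqseq_cons uiNz.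
Qed.

Lemma aprod_sum_letters (X : eqType) (I : finType) (u : I -> X) (y : I -> W)
    (m : seq X) :
  aprod [seq \sum_(i | u i == v) y i | v <- m] =
    \sum_(k : (size m).-tuple I | map u k == m) aprod (map y k).
Proof.
case: m => [|v m] /=.
  by rewrite big1 // => k _; rewrite (tuple0 k).
rewrite (linear_sum_cond _ _ _ (foldl_amul_linear _)).
rewrite (sum_cons_tuple _ (fun k => map u k == v :: m)
  (fun k => aprod (map y k))).
rewrite big_mkcond /=; apply: eq_bigr => i _.
case: (u i =P v) => [->|/eqP/negPf uiNz].
  by rewrite foldl_sum_letters; apply: eq_bigl => k; rewrite eqseq_cons eqxx.
by rewrite big_pred0 // => k; rewrite eqseq_cons uiNz.
Qed.

Lemma aprod_linear_letter (s1 s2 : seq W) :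
  linear (fun z => aprod (s1 ++ z :: s2)).
Proof.
move=> c x y; case: s1 => [|z s1] /=; first exact: foldl_amul_linear.
by rewrite !foldl_cat /= amul_linr foldl_amul_linear.
Qed.

End Words.

Lemma aprod_tens (F : fieldType) (A B : assocAlg F) (I : Type) (a : I -> A)
    (b : I -> B) (k : seq I) :
  @aprod F (tensor_alg A B) [seq tens (a i) (b i) | i <- k] =
    tens (aprod (map a k)) (aprod (map b k)).
Proof.
case: k => [|i k] /=; first by rewrite (linear_0 (tens_linl _)).
elim: k (a i) (b i) => [|j k IHk] x y //=.
by rewrite -IHk -tensor_mul_tens.
Qed.

Lemma env_val_aprod (F : fieldType) (G : finGroupType) (A B : gradedAlg F G)
    (s : seq (envelope A B)) :
  env_val (aprod s) = @aprod F (tensor_alg A B) (map (@env_val F G A B) s).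
Proof. by case: s => [|x s] //=; elim: s x => [|y s IHs] x //=; rewrite IHs. Qed.

(** * Nonzero pure tensors *)

(** A subspace M maximal among those that avoid a is a complement of the line
    through a, because enlarging M by any x outside it captures a.  The
    functional is then the coordinate along a. *)
Lemma exists_functional (F : fieldType) (V : lmodType F) (a : V) :
  a <> 0 -> exists phi : V -> F^o, linear phi /\ phi a = 1.
Proof.
move=> a_neq0.
pose avoiding : set (set V) := fun M =>
  (forall c x y, M x -> M y -> M (c *: x + y)) /\ ~ M a.
have [|M [[Mlin MNa] Mmax]] := @Zorn_bigcup V avoiding.
  move=> C Cavoid Cchain; split=> [c x y [X CX Xx] [Y CY Yy]|[X CX Xa]].
    have [XY|YX] := Cchain _ _ CX CY.
      by exists Y => //; apply: (Cavoid _ CY).1 => //; apply: XY.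
    by exists X => //; apply: (Cavoid _ CX).1 => //; apply: YX.
  exact: (Cavoid _ CX).2 Xa.
have extend (N : set V) :
    (forall c x y, N x -> N y -> N (c *: x + y)) -> (M `<=` N)%classic ->
    ~ (N `<=` M)%classic -> N a.
  by move=> Nlin MN NM; apply: contrapT => NNa; apply: (Mmax N).
(* The empty set is also stable under c *: x + y, so this needs maximality. *)
have M0 : M 0.
  apply: contrapT => MN0.
  have [[x Mx]|Mempty] := pselect (exists x, M x).
    by apply: MN0; have := Mlin (-1) _ _ Mx Mx; rewrite scaleN1r addNr.
  apply: a_neq0; apply: (extend (fun x => x = 0)) => [c x y -> ->|x Mx|].
  - by rewrite scaler0 addr0.
  - by case: Mempty; exists x.
  - by move=> sub; case: Mempty; exists 0; apply: sub.
have MZ c x : M x -> M (c *: x) by move=> Mx; rewrite -[_ *: _]addr0; apply: Mlin.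
have MB x y : M x -> M y -> M (y - x).
  by move=> Mx My; rewrite addrC -scaleN1r; apply: Mlin.
have complement x : exists c, M (x - c *: a).
  have [Mx|MNx] := pselect (M x); first by exists 0; rewrite scale0r subr0.
  have [c [m [Mm aE]]] : exists c m, M m /\ a = c *: x + m.
    apply: (extend (fun z => exists c m, M m /\ z = c *: x + m)).
    - move=> d _ _ [c [m [Mm ->]]] [c' [m' [Mm' ->]]].
      exists (d * c + c'), (d *: m + m'); split; first exact: Mlin.
      by rewrite scalerDr scalerDl scalerA addrACA.
    - by move=> z Mz; exists 0, z; rewrite scale0r add0r.
    - by move/(_ x) => sub; apply/MNx/sub; exists 1, 0; rewrite scale1r addr0.
  have [c0|c_neq0] := eqVneq c 0.
    by case: MNa; rewrite aE c0 scale0r add0r.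
  exists c^-1; rewrite aE scalerDr scalerA mulVf // scale1r opprD addNKr.
  by rewrite -scaleN1r; apply: (MZ); apply: MZ.
have [phi phiP] := choice complement.
have phi_uniq x c : M (x - c *: a) -> phi x = c.
  move=> Mc; apply/eqP; rewrite -subr_eq0; apply: contraT => neq0.
  case: MNa; rewrite -[a]scale1r -(mulVf neq0) -scalerA scalerBl; apply: MZ.
  by have := MB _ _ (phiP x) Mc; rewrite opprB addrC addrA subrK.
exists phi; split=> [c x y|]; last by apply: phi_uniq; rewrite scale1r subrr.
apply: phi_uniq; rewrite scalerDl opprD addrACA -[_ *: (phi x : F^o)]/(c * phi x).
by rewrite -scalerA -scalerBr; apply: Mlin.
Qed.

(** If a is nonzero, a functional phi with phi a = 1 induces the map
    x (x) y |-> phi x *: y, which sends a (x) b to b. *)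
Lemma tens_eq0 (F : fieldType) (A B : lmodType F) (a : A) (b : B) :
  tens a b = 0 -> a = 0 \/ b = 0.
Proof.
move=> ab0; have [->|/eqP a_neq0] := eqVneq a 0; [by left|right].
have [phi [phiL phia]] := exists_functional a_neq0.
pose contract (x : A) (y : B) : B := (phi x : F) *: y.
have contractl y : linear (contract^~ y).
  by move=> c x x'; rewrite /contract phiL scalerDl scalerA.
have contractr x : linear (contract x).
  by move=> c y y'; rewrite /contract scalerDr !scalerA mulrC.
have := tensor_lift_tens contractl contractr a b.
rewrite ab0 /contract phia scale1r => <-.
exact: linear_0 (tensor_lift_lin contractl contractr).
Qed.

(** * Reordering homogeneous words *)

Section Reordering.
Variables (F : fieldType) (G : finGroupType).

Definition commutes_by (theta : G -> G -> F) (A : gradedAlg F G) : Prop :=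
  forall g h (a b : A), a \in gcomp A g -> b \in gcomp A h ->
    amul a b = theta g h *: amul b a.

(** The list records the pairs of degrees of the letters exchanged by successive
    adjacent swaps.  Keeping the swaps rather than their scalar separates what
    depends on the word from what depends on theta. *)
Definition swap_factor (theta : G -> G -> F) (L : seq (G * G)) : F :=
  \prod_(gh <- L) theta gh.1 gh.2.

Definition homogeneous (A : gradedAlg F G) (I : Type) (d : I -> G)
  (a : I -> A) : Prop := forall i, a i \in gcomp A (d i).

(** In this lemma and the next two the list of swaps is chosen before theta and
    the algebra, so that the same word can later be reordered in several
    algebras at once. *)
Lemma foldl_bring_forward (I : Type) (d : I -> G) (i : I) (s1 s2 : seq I) :
  exists L, forall theta A, commutes_by theta A -> forall a : I -> A,
    homogeneous d a -> forall x,
    foldl amul x (map a (s1 ++ i :: s2)) =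
      swap_factor theta L *: foldl amul x (map a (i :: s1 ++ s2)).
Proof.
elim: s1 => [|j s1 [L LP]].
  by exists [::] => theta A _ a _ x; rewrite /swap_factor big_nil scale1r.
exists ((d j, d i) :: L) => theta A thetaA a aP x.
rewrite [LHS]/= (LP theta A thetaA a aP) /= -!amulA.
rewrite (thetaA _ _ _ _ (aP j) (aP i)) amulZr foldl_amulZ scalerA.
by rewrite /swap_factor big_cons mulrC.
Qed.

Lemma foldl_reorder (I : eqType) (d : I -> G) (s t : seq I) : perm_eq s t ->
  exists L, forall theta A, commutes_by theta A -> forall a : I -> A,
    homogeneous d a -> forall x,
    foldl amul x (map a t) = swap_factor theta L *: foldl amul x (map a s).
Proof.
elim: s t => [|i s IHs] t.
  move=> /perm_size/esym/size0nil ->.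
  by exists [::] => theta A _ a _ x; rewrite /swap_factor big_nil scale1r.
move=> st; have it : i \in t by rewrite -(perm_mem st) mem_head.
case/splitPr: it st => t1 t2.
rewrite perm_sym (perm_catCA t1 [:: i] t2) perm_cons.
rewrite perm_sym => /IHs[L LP]; have [L1 L1P] := foldl_bring_forward d i t1 t2.
exists (L1 ++ L) => theta A thetaA a aP x.
rewrite (L1P theta A thetaA a aP) /= (LP theta A thetaA a aP) scalerA.
by rewrite /swap_factor big_cat.
Qed.

(** [foldl_reorder] permutes letters behind a fixed product, and in [aprod] that
    product is the first letter itself.  So the first letter of t is exchanged
    with the head of s separately when the two differ in position. *)
Lemma aprod_reorder (I : eqType) (d : I -> G) (s t : seq I) : perm_eq s t ->
  exists L, forall theta A, commutes_by theta A -> forall a : I -> A,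
    homogeneous d a ->
    aprod (map a t) = swap_factor theta L *: aprod (map a s).
Proof.
case: s => [|i s].
  move=> /perm_size/esym/size0nil ->.
  by exists [::] => theta A _ a _; rewrite /= scaler0.
move=> st; have it : i \in t by rewrite -(perm_mem st) mem_head.
case/splitPr: it st => [[|j t1] t2].
  rewrite perm_cons => /(foldl_reorder d)[L LP].
  by exists L => theta A thetaA a aP; apply: LP.
rewrite perm_sym (perm_catCA (j :: t1) [:: i] t2) perm_cons perm_sym.
move=> /(foldl_reorder d)[L LP]; have [L1 L1P] := foldl_bring_forward d i t1 t2.
exists (L1 ++ (d j, d i) :: L) => theta A thetaA a aP.
rewrite [LHS](L1P theta A thetaA a aP) /= (thetaA _ _ _ _ (aP j) (aP i)).
rewrite foldl_amulZ -[foldl _ _ _]/(foldl amul (a i) (map a (j :: t1 ++ t2))).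
rewrite (LP theta A thetaA a aP) !scalerA.
by rewrite /swap_factor big_cat /= big_cons mulrA.
Qed.

Lemma swap_factorM theta eta L :
  swap_factor (fun g h => theta g h * eta g h) L =
    swap_factor theta L * swap_factor eta L.
Proof. exact: big_split. Qed.

Lemma swap_factor_neq0 theta L :
  (forall g h, theta g h != 0) -> swap_factor theta L != 0.
Proof.
move=> theta_neq0; apply: (big_ind (fun x => x != 0)) => [|x y|gh _] //.
  exact: oner_neq0.
exact: mulf_neq0.
Qed.

Lemma swap_factor_one theta L :
  (forall g h, theta g h = 1) -> swap_factor theta L = 1.
Proof. by move=> theta1; apply: big1 => gh _. Qed.

End Reordering.

(** * Multilinear identities *)

Section Multilinear.
Variables (F : fieldType) (G : finGroupType).

(** The value at w of the multilinear polynomial with coefficient c s at the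
    word x_(s 0) .. x_(s (n-1)). *)
Definition mlin_eval (W : gradedAlg F G) n (c : 'S_n -> F) (w : 'I_n -> W) : W :=
  \sum_(s : 'S_n) c s *: aprod [seq w (s i) | i <- enum 'I_n].

Definition mlin_identity (W : gradedAlg F G) n (g : 'I_n -> G) (c : 'S_n -> F) :=
  forall w : 'I_n -> W, homogeneous g w -> mlin_eval c w = 0.

Arguments mlin_identity W {n} g c.

Lemma gcomp_sum (W : gradedAlg F G) g (I : Type) (r : seq I) (E : I -> W) :
  (forall i, E i \in gcomp W g) -> \sum_(i <- r) E i \in gcomp W g.
Proof.
have [g0 gP] := gcomp_submod W g; move=> EP.
apply: (big_rec (fun x => x \in gcomp W g)) => [|i x _ xP]; first exact: g0.
by rewrite -[E i]scale1r; apply: gP.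
Qed.

Lemma gcompZ (W : gradedAlg F G) g c (x : W) :
  x \in gcomp W g -> c *: x \in gcomp W g.
Proof.
by move=> xP; have [g0 gP] := gcomp_submod W g; rewrite -[_ *: _]addr0 gP.
Qed.

(** Each word of the sum is a permutation of the variables, so it contains x_j
    exactly once. *)
Lemma mlin_eval_linear (W : gradedAlg F G) n (c : 'S_n -> F) (w : 'I_n -> W) j :
  linear (fun z => mlin_eval c (fun i => if i == j then z else w i)).
Proof.
move=> a x y; rewrite /mlin_eval scaler_sumr -big_split /=.
apply: eq_bigr => s _.
pose wj z i := if i == j then z else w i.
suff lin_s : linear (fun z => aprod [seq wj z (s i) | i <- enum 'I_n]).
  by rewrite lin_s scalerDr !scalerA mulrC.
have js : j \in map s (enum 'I_n).
  by rewrite -[j](permKV s) map_f // mem_enum.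
have s_uniq : uniq (map s (enum 'I_n)).
  by rewrite (map_inj_uniq perm_inj) enum_uniq.
have split_s z : [seq wj z (s i) | i <- enum 'I_n] =
    map (wj z) (map s (enum 'I_n)) by exact: (map_comp (wj z) s).
case/splitPr: js s_uniq split_s => s1 s2 s_uniq split_s.
have [jNs1 jNs2] : j \notin s1 /\ j \notin s2.
  move: s_uniq; rewrite cat_uniq /= negb_or => /and3P[_ /andP[jNs1 _]].
  by case/andP.
have fixed r z : j \notin r -> map (wj z) r = map w r.
  move=> jNr; apply/eq_in_map => i ir; rewrite /wj.
  by case: eqP ir jNr => // -> ->.
move=> b x1 y1; rewrite !split_s !map_cat /= !(fixed s1) // !(fixed s2) //.
by rewrite /wj eqxx; apply: aprod_linear_letter.
Qed.

(** Multilinearity lets the variables be replaced one at a time by elements of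
    the spanning family; m counts those that are still arbitrary. *)
Lemma mlin_identity_span (W : gradedAlg F G) n (g : 'I_n -> G) (c : 'S_n -> F)
    (S : G -> W -> Prop) :
    (forall h x, S h x -> x \in gcomp W h) ->
    (forall h x, x \in gcomp W h -> exists r : seq W,
       (forall y, y \in r -> S h y) /\ x = \sum_(y <- r) y) ->
  (forall w, (forall i, S (g i) (w i)) -> mlin_eval c w = 0) ->
  mlin_identity W g c.
Proof.
move=> Shom Sspan cS w wP.
suff spanned m : (m <= n)%N -> forall w : 'I_n -> W, homogeneous g w ->
    (forall i : 'I_n, (m <= i)%N -> S (g i) (w i)) -> mlin_eval c w = 0.
  by apply: (spanned n) => // i; rewrite leqNgt ltn_ord.
clear w wP; elim: m => [_ w1 _ wS|m IHm lt_mn w wP wS].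
  by apply: cS => i; apply: wS.
pose j := Ordinal lt_mn; have [r [rS wjE]] := Sspan _ _ (wP j).
pose wj z i := if i == j then z else w i.
have <- : mlin_eval c (wj (w j)) = mlin_eval c w.
  by congr mlin_eval; apply: funext => i; rewrite /wj; case: eqP => [->|].
rewrite wjE (linear_sum_cond _ _ _ (mlin_eval_linear c w j)) big_seq big1 //.
move=> y yr; apply: IHm => [|i|i lt_mi]; first exact: ltnW.
  by case: eqP => [->|//]; apply: Shom (rS _ yr).
case: (i =P j) => [->|iNj]; first exact: rS.
apply: wS; rewrite ltn_neqAle lt_mi andbT; apply/eqP => mi.
by case: iNj; apply: val_inj.
Qed.

End Multilinear.

(** * Multilinear identities of an envelope *)

Section Envelopes.
Variables (F : fieldType) (G : finGroupType).

Lemma pure_tensor_comp (A B : gradedAlg F G) g (a : A) (b : B) :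
  a \in gcomp A g -> b \in gcomp B g -> tens a b \in tensor_comp g.
Proof.
move=> aP bP; apply/asboolP; exists [:: (a, b)].
by rewrite /= aP bP big_seq1.
Qed.

Definition pure_in (A B : gradedAlg F G) g (x : envelope A B) : Prop :=
  exists ab : A * B, [/\ ab.1 \in gcomp A g, ab.2 \in gcomp B g &
    env_val x = tens ab.1 ab.2].

Lemma pure_in_ex (A B : gradedAlg F G) g (a : A) (b : B) :
  a \in gcomp A g -> b \in gcomp B g ->
  exists2 x : envelope A B, x \in gcomp (envelope A B) g & env_val x = tens a b.
Proof.
move=> aP bP; have tP := pure_tensor_comp aP bP.
by exists (EnvelopeElt (tensor_comp_env tP)).
Qed.

Lemma pure_in_comp (A B : gradedAlg F G) g (x : envelope A B) :
  pure_in g x -> x \in gcomp (envelope A B) g.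
Proof.
case=> [[a b] [/= aP bP xE]].
by rewrite -topredE /= /env_comp xE; apply: pure_tensor_comp.
Qed.

Lemma env_comp_pure (A B : gradedAlg F G) g (x : envelope A B) :
  x \in gcomp (envelope A B) g -> exists r : seq (envelope A B),
    (forall y, y \in r -> pure_in g y) /\ x = \sum_(y <- r) y.
Proof.
case: x => t tP /asboolP[/= s [sP tE]].
suff [r [rP rE]] : exists r : seq (envelope A B),
    (forall y, y \in r -> pure_in g y) /\
    env_val (\sum_(y <- r) y) = \sum_(k <- s) tens k.1 k.2.
  by exists r; split=> //; apply: val_inj; rewrite /= rE.
elim: s sP {tE} => [_|[a b] s IHs /= /andP[/andP[aP bP] /IHs[r [rP rE]]]].
  by exists [::]; split=> //; rewrite !big_nil.
have [x _ xE] := pure_in_ex aP bP.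
exists (x :: r); split=> [y|]; last by rewrite !big_cons /= xE rE.
by rewrite inE => /predU1P[->|/rP //]; exists (a, b).
Qed.

Lemma mlin_identity0 (W : gradedAlg F G) (g : 'I_0 -> G) c :
  mlin_identity W g c.
Proof.
move=> w _; rewrite /mlin_eval big1 // => s _.
by rewrite enum_ord0 scaler0.
Qed.

Lemma env_val_mlin_eval (A B : gradedAlg F G) n c (w : 'I_n -> envelope A B)
    (a : 'I_n -> A) (b : 'I_n -> B) :
  (forall i, env_val (w i) = tens (a i) (b i)) ->
  env_val (mlin_eval c w) =
    \sum_(s : 'S_n) c s *: tens (aprod [seq a (s i) | i <- enum 'I_n])
                                (aprod [seq b (s i) | i <- enum 'I_n]).
Proof.
move=> wE; transitivity
  (\sum_(s : 'S_n) env_val (c s *: aprod [seq w (s i) | i <- enum 'I_n])).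
  exact: (raddf_sum val).
apply: eq_bigr => s _; rewrite -[LHS]/(c s *: env_val _) env_val_aprod -map_comp.
rewrite -(aprod_tens (fun i => a (s i)) (fun i => b (s i))).
by congr (_ *: @aprod F (tensor_alg A B) _); apply: eq_map => i /=.
Qed.

(** Sorting the A-parts of the words turns the value of c at pure tensors into
    one pure tensor a (x) b, with a the sorted product and b the value of the
    rescaled polynomial.  One direction chooses the a_i with nonzero product,
    the other only needs pure tensors because they span. *)
Lemma mlin_identity_envelope n (g : 'I_n -> G) :
  exists L : 'S_n -> seq (G * G),
  forall (theta : G -> G -> F) (A : gradedAlg F G), regular_with theta A ->
  forall (B : gradedAlg F G) c, mlin_identity (envelope A B) g c <->
    mlin_identity B g (fun s => swap_factor theta (L s) * c s).
Proof.
case: n g => [|n] g.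
  by exists (fun=> [::]) => theta A _ B c; split=> _; apply: mlin_identity0.
have perm_enum (s : 'S_n.+1) : perm_eq (enum 'I_n.+1) (map s (enum 'I_n.+1)).
  apply: uniq_perm; rewrite ?(map_inj_uniq perm_inj) ?enum_uniq // => i.
  by rewrite mem_enum -[i](permKV s) map_f // mem_enum.
have [L LP] := choice (fun s => @aprod_reorder F _ _ g _ _ (perm_enum s)).
exists L => theta A [_ A_nonzero thetaA] B c.
have factor (a : 'I_n.+1 -> A) (b : 'I_n.+1 -> B) : homogeneous g a ->
    \sum_(s : 'S_n.+1) c s *: tens (aprod [seq a (s i) | i <- enum 'I_n.+1])
                                (aprod [seq b (s i) | i <- enum 'I_n.+1]) =
    tens (aprod (codom a))
      (mlin_eval (fun s => swap_factor theta (L s) * c s) b).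
  move=> aP; rewrite /mlin_eval (linear_sum_cond _ _ _ (tens_linr _)).
  apply: eq_bigr => s _.
  rewrite [in LHS](map_comp a s) (LP s theta A thetaA a aP).
  rewrite (linear_Z (tens_linl _)) (linear_Z (tens_linr _)) scalerA.
  by rewrite [c s * _]mulrC.
split=> [idAB b bP|idB].
  have [a [aP a_neq0]] := A_nonzero n g.
  have [w wP] := choice (fun i => let: ex_intro2 x xP xE :=
    pure_in_ex (aP i) (bP i) in ex_intro _ x (conj xP xE)).
  have := congr1 (@env_val _ _ _ _) (idAB w (fun i => (wP i).1)).
  by rewrite (env_val_mlin_eval _ (fun i => (wP i).2)) factor // => /tens_eq0[].
apply: (mlin_identity_span (@pure_in_comp A B) (@env_comp_pure A B)).
move=> w /choice[ab abP]; apply: val_inj.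
have aP : homogeneous g (fun i => (ab i).1) by move=> i; have [] := abP i.
have bP : homogeneous g (fun i => (ab i).2) by move=> i; have [] := abP i.
have wE i : env_val (w i) = tens (ab i).1 (ab i).2 by have [] := abP i.
apply: etrans (env_val_mlin_eval c wE) _.
apply: etrans (factor _ (fun i => (ab i).2) aP) _.
by rewrite idB //; apply: (linear_0 (tens_linr _)).
Qed.

End Envelopes.

(** * Polarization in characteristic zero *)

Section Linearization.
Variables (F : fieldType) (G : finGroupType).
Implicit Types (W : gradedAlg F G) (p : free_alg F G).

Definition word_coef p (s : seq (gvar G)) : F := p@_(FMonom s).

(** Each word of p expands into the words in the labels that spell it, and a word
    in the labels spells at most one word of p; hence the coefficient. *)
Lemma eval_nonconst_letters W p n (u : 'I_n -> gvar G) (y : 'I_n -> W) N :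
    (forall m : {fmonom gvar G}, m \in msupp p -> size m < N)%N ->
  eval_nonconst (fun x => \sum_(i | u i == x) y i) p =
    \sum_(l < N) \sum_(k : l.-tuple 'I_n)
      word_coef p (map u k) *: aprod (map y k).
Proof.
move=> size_p; rewrite /eval_nonconst.
transitivity (\sum_(m <- msupp p) \sum_(l < N) \sum_(k : l.-tuple 'I_n)
    (if map u k == m then p@_m *: aprod (map y k) else 0)).
  apply: eq_big_seq => m /size_p lt_m; rewrite aprod_sum_letters.
  rewrite (bigD1 (Ordinal lt_m)) //= [X in _ + X]big1 ?addr0 => [|l lNm].
    by rewrite scaler_sumr -big_mkcond.
  rewrite big1 // => k _; case: eqP => // ukm.
  case/eqP: lNm; apply: val_inj => /=.
  by rewrite -ukm size_map size_tuple.
rewrite exchange_big; apply: eq_bigr => l _ /=.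
rewrite exchange_big; apply: eq_bigr => k _ /=.
have [km|kNm] := boolP (FMonom (map u k) \in msupp p).
  rewrite (big_fsetD1 _ km) /= eqxx [X in _ + X]big1_seq ?addr0 // => m.
  rewrite !inE => /and3P[_ mNk _]; case: eqP => // ukm.
  by case/eqP: mNk; apply: val_inj.
rewrite /word_coef (mcoeff_outdom kNm) scale0r big_seq big1 // => m mp.
case: eqP => // ukm; case/negP: kNm.
by rewrite (_ : FMonom _ = m) //; apply: val_inj.
Qed.

Lemma eval_nonconst_eq W p (s s' : gvar G -> W) :
    (forall (m : {fmonom gvar G}) x, m \in msupp p -> x \in (m : seq _) ->
      s x = s' x) ->
  eval_nonconst s p = eval_nonconst s' p.
Proof.
move=> ss'; apply: eq_big_seq => m mp; congr (_ *: aprod _).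
by apply/eq_in_map => x; apply: ss'.
Qed.

Lemma exists_size_bound p : exists N,
  (forall m : {fmonom gvar G}, m \in msupp p -> size m < N)%N.
Proof.
exists (\max_(m <- msupp p) size (m : seq (gvar G))).+1 => m mp.
by rewrite ltnS (leq_bigmax_seq _ mp).

Qed.

Lemma permuted_tuple_bij l (T : finType) (s : 'S_l) :
  bijective (fun k : l.-tuple T => [tuple tnth k (s i) | i < l]).
Proof.
exists (fun k : l.-tuple T => [tuple tnth k (s^-1%g i) | i < l]) => k;
  by apply: eq_from_tnth => i; rewrite !tnth_mktuple ?permK ?permKV.
Qed.

(** The full polarization at the word u: the letters of u are made distinct, and
    a permutation of them gets the coefficient in p of the permuted word. *)
Definition polarization p n (u : 'I_n -> gvar G) : 'S_n -> F :=
  fun s => word_coef p [seq u (s i) | i <- enum 'I_n].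

(** The sum over all words of length l is unchanged when their positions are
    permuted by s.  Adding these l! equal sums and grouping by word gives a sum of
    values of polarizations. *)
Lemma words_sum_eq0 W p n (u : 'I_n -> gvar G) (y : 'I_n -> W) l :
    [pchar F] =i pred0 -> (forall i, y i \in gcomp W (u i).1) ->
    (forall v : 'I_l -> gvar G,
       mlin_identity W (fun i => (v i).1) (polarization p v)) ->
  \sum_(k : l.-tuple 'I_n) word_coef p (map u k) *: aprod (map y k) = 0.
Proof.
move=> /pcharf0P charF0 yP polar.
set X := \sum_k _.
have : #|{: 'S_l}|%:R *: X = 0.
  transitivity (\sum_(s : 'S_l) X).
    by rewrite sumr_const scaler_nat; congr (_ *+ _); apply: eq_card.
  transitivity (\sum_(s : 'S_l) \sum_(k : l.-tuple 'I_n)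
    polarization p (fun i => u (tnth k i)) s *:
      aprod [seq y (tnth k (s i)) | i <- enum 'I_l]).
    apply: eq_bigr => s _.
    rewrite /X (reindex _ (onW_bij _ (permuted_tuple_bij 'I_n s))) /=.
    by apply: eq_bigr => k _; rewrite /polarization -!map_comp.
  rewrite exchange_big big1 //= => k _.
  by apply: (polar (fun i => u (tnth k i)) (fun i => y (tnth k i))) => i.
move/eqP; rewrite scaler_eq0 charF0 card_Sn => /orP[|/eqP //].
by rewrite eqn0Ngt fact_gt0.
Qed.

Lemma prod_letter_counts (R : comNzRingType) n (t : 'I_n -> R) (k : seq 'I_n) :
  \prod_(i <- k) t i = \prod_i t i ^+ count_mem i k.
Proof.
elim: k => [|j k IHk]; first by rewrite big_nil big1.
under [RHS]eq_bigr do rewrite /= exprD.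
rewrite big_split big_cons IHk; congr (_ * _).
rewrite (bigD1 j) //= eqxx expr1.
by rewrite big1 ?mulr1 // => i /negPf; rewrite eq_sym => ->.
Qed.

(** A linear combination of evaluations that extracts the coefficient of t from
    any polynomial in t of degree below N, with coefficients in any vector
    space. *)
Lemma linear_coef_weights N : [pchar F] =i pred0 ->
  exists t w : 'I_N -> F, forall m, (m < N)%N ->
    \sum_j w j * t j ^+ m = (m == 1)%:R.
Proof.
move=> /pcharf0P charF0.
pose a : 'rV[F]_N := \row_j (j%:R : F).
have V_unit : Vandermonde N a \in unitmx.
  rewrite unitmxE unitfE det_Vandermonde; apply/prodf_neq0 => i _.
  apply/prodf_neq0 => j lt_ij; rewrite !mxE -natrB ?(ltnW lt_ij) //.
  by rewrite charF0 subn_eq0 -ltnNge.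
pose w := invmx (Vandermonde N a) *m (\col_(i < N) ((i == 1 :> nat)%:R : F)).
exists (fun j => a 0 j), (fun j => w j 0) => m lt_m.
have := congr1 (fun M : 'cV_N => M (Ordinal lt_m) 0)
  (mulKVmx V_unit (\col_(i < N) ((i == 1 :> nat)%:R : F))).
rewrite -/w !mxE /= => <-.
by apply: eq_bigr => j _; rewrite !mxE mulrC.
Qed.

Lemma sum_permuted_words (V : nmodType) n (E : seq 'I_n -> V) :
  \sum_(k : n.-tuple 'I_n | perm_eq k (enum 'I_n)) E k =
    \sum_(s : 'S_n) E [seq s i | i <- enum 'I_n].
Proof.
pose word (s : 'S_n) := [tuple s i | i < n].
pose perm_of (k : n.-tuple 'I_n) := odflt 1%g [pick s | word s == k].
have word_inj : injective word.
  move=> s s' /(congr1 (fun k => tnth k _)) eq_ss'; apply/permP => i.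
  by have := eq_ss' i; rewrite !tnth_mktuple.
have wordK s : perm_of (word s) = s.
  rewrite /perm_of; case: pickP => [s' /eqP/word_inj //|/(_ s)].
  by rewrite eqxx.
have word_perm s : perm_eq (word s) (enum 'I_n).
  apply: uniq_perm; rewrite ?(map_inj_uniq perm_inj) ?enum_uniq // => i.
  by rewrite mem_enum -[i](permKV s) map_f // mem_enum.
rewrite (reindex_onto word perm_of) => [|k].
  by apply: eq_bigl => s; rewrite word_perm wordK eqxx.
move=> k_perm; have k_inj : injective (tnth k).
  by apply/tuple_uniqP; rewrite (perm_uniq k_perm) enum_uniq.
rewrite (_ : k = word (perm k_inj)) ?wordK //.
by apply: eq_from_tnth => i; rewrite tnth_mktuple permE.
Qed.

(** p is evaluated at the elements sum_(i | u i = x) t_i y_i.  The weights of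
    [linear_coef_weights], applied to each t_i separately, keep of the
    expansion over words in the labels just the words of degree 1 in each t_i. *)
Lemma polarization_identity W p n (u : 'I_n -> gvar G) :
    [pchar F] =i pred0 ->
    (forall s : gvar G -> W, graded_subst s -> eval_nonconst s p = 0) ->
  mlin_identity W (fun i => (u i).1) (polarization p u).
Proof.
move=> charF0 p_vanishes y yP.
(* N exceeds n as well, so that the words of length n are in range. *)
have [N0 size_p] := exists_size_bound p; pose N := maxn N0 n.+1.
have {}size_p (m : {fmonom gvar G}) : m \in msupp p -> (size m < N)%N.
  by move=> /size_p lt_m; rewrite (leq_trans lt_m) // leq_maxl.
have lt_nN : (n < N)%N by rewrite leq_maxr.
have [t [w wtE]] := linear_coef_weights N charF0.
have scaled (f : {ffun 'I_n -> 'I_N}) : \sum_(l < N) \sum_(k : l.-tuple 'I_n)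
    word_coef p (map u k) *: ((\prod_(i <- k) t (f i)) *: aprod (map y k)) = 0.
  under eq_bigr do under eq_bigr do rewrite -aprodZ.
  rewrite -eval_nonconst_letters //; apply: p_vanishes => x.
  rewrite big_mkcond; apply: gcomp_sum => i.
  case: eqP => [<-|_]; first exact: gcompZ.
  by have [] := gcomp_submod W x.1.
have weighted l (k : l.-tuple 'I_n) : (l < N)%N ->
    \sum_(f : {ffun 'I_n -> 'I_N})
      (\prod_i w (f i)) * \prod_(i <- k) t (f i) =
    (perm_eq k (enum 'I_n))%:R.
  move=> lt_l; transitivity (\sum_(f : {ffun 'I_n -> 'I_N})
      \prod_i (w (f i) * t (f i) ^+ count_mem i k)).
    by apply: eq_bigr => f _; rewrite (prod_letter_counts _ k) big_split.
  transitivity (\prod_i \sum_j w j * t j ^+ count_mem i k).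
    by rewrite bigA_distr_bigA.
  transitivity (\prod_i (count_mem i k == 1)%:R : F).
    apply: eq_bigr => i _; rewrite wtE //.
    by rewrite (leq_ltn_trans _ lt_l) // -[leqRHS](size_tuple k) count_size.
  have [k_perm|k_Nperm] := boolP (perm_eq k _).
    rewrite big1 // => i _.
    rewrite (seq.permP k_perm) count_uniq_mem ?enum_uniq //.
    by rewrite mem_enum.
  have [i ki] : exists i, count_mem i k != 1.
    apply/existsP; rewrite -negb_forall; apply: contra k_Nperm => /forallP k1.
    apply/allP => i _ /=; rewrite (eqP (k1 i)).
    by rewrite count_uniq_mem ?enum_uniq // mem_enum.
  by rewrite (bigD1 i) //= (negPf ki) mul0r.
pose E (k : seq 'I_n) := word_coef p (map u k) *: aprod (map y k).
transitivity (\sum_(l < N) \sum_(k : l.-tuple 'I_n)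
    (perm_eq k (enum 'I_n))%:R *: E k).
  transitivity (\sum_(s : 'S_n) E [seq s i | i <- enum 'I_n]).
    by apply: eq_bigr => s _; rewrite /polarization (map_comp u s) (map_comp y s).
  rewrite -sum_permuted_words (bigD1 (Ordinal lt_nN)) //=.
  rewrite [X in _ + X]big1 ?addr0 => [|l lNn].
    by rewrite big_mkcond; apply: eq_bigr => k _; rewrite scaler_nat mulrb.
  rewrite big1 // => k _; case: (boolP (perm_eq k _)) => [k_perm|_].
    case/eqP: lNn; apply: val_inj; rewrite /= -(size_tuple k).
    by rewrite (perm_size k_perm) size_enum_ord.
  by rewrite scale0r.
transitivity (\sum_(f : {ffun 'I_n -> 'I_N}) (\prod_i w (f i)) *:
    \sum_(l < N) \sum_(k : l.-tuple 'I_n) (\prod_(i <- k) t (f i)) *: E k).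
  under [RHS]eq_bigr do rewrite scaler_sumr.
  rewrite exchange_big; apply: eq_bigr => l _ /=.
  under [RHS]eq_bigr do rewrite scaler_sumr.
  rewrite exchange_big; apply: eq_bigr => k _ /=.
  rewrite -(weighted l k) // scaler_suml.
  by apply: eq_bigr => f _; rewrite scalerA.
rewrite big1 // => f _.
suff -> : \sum_(l < N) \sum_(k : l.-tuple 'I_n)
    (\prod_(i <- k) t (f i)) *: E k = 0 by rewrite scaler0.
apply: etrans (scaled f); apply: eq_bigr => l _; apply: eq_bigr => k _.
by rewrite /E !scalerA mulrC.
Qed.

(** For the backward direction, the letters occurring in p serve as labels, so
    that any substitution has the form treated by [eval_nonconst_letters]. *)
Lemma eval_nonconst_eq0P W p : [pchar F] =i pred0 ->
  (forall s : gvar G -> W, graded_subst s -> eval_nonconst s p = 0) <->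
  (forall n (u : 'I_n -> gvar G),
     mlin_identity W (fun i => (u i).1) (polarization p u)).
Proof.
move=> charF0; split=> [p_vanishes n u|polar s sP].
  exact: polarization_identity.
pose letters := undup (flatten [seq fmonom_val m | m <- msupp p]).
pose u (i : 'I_(size letters)) := tnth (in_tuple letters) i.
have [N size_p] := exists_size_bound p.
rewrite (@eval_nonconst_eq _ _ _ (fun x => \sum_(i | u i == x) s (u i))).
  rewrite (eval_nonconst_letters _ _ size_p) big1 // => l _.
  by apply: words_sum_eq0.
move=> m x mp xm; have : x \in letters.
  by rewrite mem_undup; apply/flattenP; exists (m : seq _) => //; apply: map_f.
move=> /(tnthP (in_tuple letters))[i xE].
rewrite (big_pred1 i) => [|j]; first by rewrite /u -xE.
have u_inj : injective u by apply/tuple_uniqP; apply: undup_uniq.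
by rewrite xE; apply: (inj_eq u_inj).
Qed.

End Linearization.

(** * Ideals of identities *)

Section IdentityIdeals.
Variables (F : fieldType) (G : finGroupType).
Implicit Types (W : gradedAlg F G) (p : free_alg F G).

Definition trivial_alg W : Prop := forall x : W, x = 0.

Lemma eval_nonconst0 W p : eval_nonconst (fun=> 0 : W) p = 0.
Proof.
rewrite /eval_nonconst big1 // => m _.
case: (m : seq _) => [|x m'] /=; first by rewrite scaler0.
by rewrite (linear_0 (foldl_amul_linear _)) scaler0.
Qed.

Lemma vanishes_atE W p (s : gvar G -> W) :
  p@_(@mone _) = 0 -> vanishes_at s p -> eval_nonconst s p = 0.
Proof. by move=> p0 [[e [_]]|[_ //]]; rewrite p0 scale0r add0r. Qed.

(** Substituting 0 everywhere shows that the constant term c of an identity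
    satisfies c *: e = 0 for a unit e, or c = 0; so c = 0 unless the algebra
    is zero. *)
Lemma Id_GP W p : [pchar F] =i pred0 ->
  Id_G W p <-> trivial_alg W \/ p@_(@mone _) = 0 /\
  forall n (u : 'I_n -> gvar G),
    mlin_identity W (fun i => (u i).1) (polarization p u).
Proof.
move=> charF0.
split=> [idp|[W0 s _|[p0 /(eval_nonconst_eq0P _ _ charF0) p_vanishes] s sP]].
- have [W0|W_nontriv] := pselect (trivial_alg W); [by left|right].
  have p0 : p@_(@mone _) = 0.
    have s0 : graded_subst (fun=> 0 : W).
      by move=> x; have [] := gcomp_submod W x.1.
    have [[e [[eL _]]]|[//]] := idp _ s0.
    rewrite eval_nonconst0 addr0 => /eqP; rewrite scaler_eq0.
    case/orP=> /eqP // e0; case: W_nontriv => x.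
    by rewrite -[x]eL e0 amul0l.
  split=> //; apply/(eval_nonconst_eq0P _ _ charF0) => s sP.
  exact: vanishes_atE (idp s sP).
- left; exists 0; split; last exact: W0.
  by split=> x; rewrite [LHS]W0 [RHS]W0.
- by right; split=> //; apply: p_vanishes.
Qed.

Lemma eval_nonconst_linear W (s : gvar G -> W) : linear (eval_nonconst s).
Proof.
have evalE (d : {fset {fmonom gvar G}}) p : (msupp p `<=` d)%fset ->
    eval_nonconst s p = \sum_(m <- d) p@_m *: aprod (map s m).
  move=> le_d; rewrite /eval_nonconst (big_fset_incl _ le_d) //= => m _.
  by move=> /mcoeff_outdom ->; rewrite scale0r.
move=> c p q; pose d := (msupp p `|` msupp q)%fset.
rewrite (evalE d p) ?fsubsetUl // (evalE d q) ?fsubsetUr // (evalE d).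
  rewrite scaler_sumr -big_split; apply: eq_bigr => m _ /=.
  by rewrite mcoeffD mcoeffZ scalerDl scalerA.
by apply: fsubset_trans (msuppD_le _ _) _; apply: fsetSU; apply: msuppZ_le.
Qed.

Lemma eval_nonconstU W (s : gvar G -> W) (m : {fmonom gvar G}) :
  eval_nonconst s << m >> = aprod (map s m).
Proof.
by rewrite /eval_nonconst msuppU oner_eq0 big_seq_fset1 mcoeffUU scale1r.
Qed.

(** The degrees g i may coincide; the second component keeps the variables
    distinct. *)
Definition mlin_poly n (g : 'I_n -> G) (c : 'S_n -> F) : free_alg F G :=
  \sum_(s : 'S_n) c s *: << FMonom [seq (g (s i), val (s i)) | i <- enum 'I_n] >>.

Lemma eval_mlin_poly W n (g : 'I_n -> G) c (s : gvar G -> W) :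
  eval_nonconst s (mlin_poly g c) = mlin_eval c (fun i => s (g i, val i)).
Proof.
rewrite /mlin_poly (linear_sum_cond _ _ _ (eval_nonconst_linear s)).
apply: eq_bigr => t _; rewrite (linear_Z (eval_nonconst_linear s)).
by rewrite eval_nonconstU -map_comp.
Qed.

(** With no variable the polynomial is a constant, hence the n.+1. *)
Lemma Id_G_mlin_poly W n (g : 'I_n.+1 -> G) c :
  Id_G W (mlin_poly g c) <-> mlin_identity W g c.
Proof.
have const0 : (mlin_poly g c)@_(@mone _) = 0.
  rewrite raddf_sum big1 //= => s _; rewrite mcoeffZ mcoeffU1.
  case: eqP => [/(congr1 (fun m : {fmonom gvar G} => size m))|]; last first.
    by rewrite mulr0.
  by rewrite fm1 /= size_map size_enum_ord.
split=> [idc w wP|idc s sP]; last first.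
  right; split=> //; rewrite eval_mlin_poly; apply: idc => i.
  exact: (sP (g i, val i)).
pose s (x : gvar G) := \sum_(i | (g i, val i) == x) w i.
have sE i : s (g i, val i) = w i.
  apply: big_pred1 => j /=; apply/eqP/eqP => [[_ ij]|->//].
  exact: val_inj.
have sP : graded_subst s.
  move=> x; rewrite /s big_mkcond; apply: gcomp_sum => i.
  case: eqP => [<-|_]; first exact: wP.
  by have [] := gcomp_submod W x.1.
have := vanishes_atE const0 (idc s sP); rewrite eval_mlin_poly.
by rewrite (funext sE).
Qed.

Lemma Id_G_one W : [pchar F] =i pred0 ->
  Id_G W << @mone _ >> <-> trivial_alg W.
Proof.
move=> charF0; rewrite (Id_GP _ _ charF0); split=> [[//|[/eqP]]|]; last by left.
by rewrite mcoeffUU oner_eq0.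
Qed.

Lemma Id_G_eqP W W' : [pchar F] =i pred0 ->
  Id_G W = Id_G W' <->
  (trivial_alg W <-> trivial_alg W') /\
  forall n (g : 'I_n -> G) c, mlin_identity W g c <-> mlin_identity W' g c.
Proof.
move=> charF0; split=> [eqId|[eq0 eq_mlin]].
  split=> [|[|n] g c]; first by rewrite -!(Id_G_one _ charF0) eqId.
    by split=> _; apply: mlin_identity0.
  by rewrite -!Id_G_mlin_poly eqId.
apply: funext => p; apply: propext; rewrite !(Id_GP _ _ charF0) eq0.
split=> -[?|[p0 idp]]; by [left|right; split=> // n u; apply/eq_mlin].
Qed.

End IdentityIdeals.

(** * Commutation functions *)

Section RegularGradings.
Variables (F : fieldType) (G : finGroupType).
Implicit Types (A B : gradedAlg F G) (theta eta : G -> G -> F).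

Lemma regular_comp_nonzero theta A : regular_with theta A ->
  forall g, exists2 a : A, a \in gcomp A g & a <> 0.
Proof.
move=> [_ nonzero _] g; have [a [aP a_neq0]] := nonzero 0 (fun=> g).
exists (a ord0) => // a0; apply: a_neq0.
by rewrite /codom /image_mem enum_ordSl enum_ord0 /= a0.
Qed.

Lemma envelope_trivial theta A B : regular_with theta A ->
  trivial_alg (envelope A B) <-> trivial_alg B.
Proof.
move=> regA; split=> [AB0 b|B0 x].
  have [f [fP ->]] := gcomp_span b; apply: big1 => g _.
  have [a aP a_neq0] := regular_comp_nonzero regA g.
  have [x _ xE] := pure_in_ex aP (fP g).
  have /tens_eq0[] : tens a (f g) = 0 by rewrite -xE (AB0 x).
    by move/a_neq0.
  by [].
apply: val_inj; apply: (@tensor_ind _ A B (fun t => t = 0)) => [//|a b|t u -> ->].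
  by rewrite (B0 b) (linear_0 (tens_linr a)).
by rewrite addr0.
Qed.

(** Moving x to the right end of a nonzero product x y z, in one step past y z
    or in two steps, gives the same scalar. *)
Lemma regular_mulr theta A : regular_with theta A ->
  forall g h k, theta g (h * k)%g = theta g h * theta g k.
Proof.
move=> [_ nonzero thetaA] g h k.
have [a [aP]] := nonzero 2 (tnth [tuple g; h; k]).
rewrite /codom /image_mem !enum_ordSl enum_ord0 /=.
move: (aP ord0) (aP (lift ord0 ord0)) (aP (lift ord0 (lift ord0 ord0))).
set x := a _; set y := a _; set z := a _.
rewrite !(tnth_nth 1%g) /= => xP yP zP xyz_neq0.
have xyzE : amul (amul x y) z = theta g (h * k)%g *: amul (amul y z) x.
  by rewrite -amulA (thetaA g (h * k)%g) // gcomp_mul.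
apply/eqP; rewrite -subr_eq0; apply/eqP.
have /eqP : (theta g (h * k)%g - theta g h * theta g k) *: amul (amul y z) x = 0.
  rewrite scalerBl -xyzE (thetaA g h x y) // amulZl -(amulA y x z).
  rewrite (thetaA g k x z) //.
  by rewrite amulZr scalerA amulA subrr.
rewrite scaler_eq0 => /orP[/eqP //|/eqP yzx0].
by case: xyz_neq0; rewrite xyzE yzx0 scaler0.
Qed.

Lemma regular_expr_card theta A : regular_with theta A ->
  forall g h, theta g h ^+ #|G| = 1.
Proof.
move=> regA g h; have theta1 : theta g 1%g = 1.
  apply: (mulfI (_ : theta g 1%g != 0)); first by have [] := regA.
  by rewrite mulr1 -(regular_mulr regA) mulg1.
have thetaX n : theta g (h ^+ n)%g = theta g h ^+ n.
  by elim: n => [|n IHn]; rewrite ?expg0 // expgS exprS (regular_mulr regA) IHn.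
have /dvdnP[k card_G] : (#[h]%g %| #|[set: G]|)%N.
  exact: (@cardSg G [set: G]%G <[h]>%G (finset.subsetT _)).
by rewrite -thetaX -cardsT card_G mulnC expgM expg_order expg1n.
Qed.

Lemma envelope_regular theta eta A B :
  regular_with theta A -> regular_with eta B ->
  regular_with (fun g h => theta g h * eta g h) (envelope A B).
Proof.
move=> [theta_neq0 nonzeroA thetaA] [eta_neq0 nonzeroB etaB]; split.
- by move=> g h; apply: mulf_neq0.
- move=> n g; have [a [aP a_neq0]] := nonzeroA n g.
  have [b [bP b_neq0]] := nonzeroB n g.
  have [w wP] := choice (fun i => let: ex_intro2 x xP xE :=
    pure_in_ex (aP i) (bP i) in ex_intro _ x (conj xP xE)).
  exists w; split=> [i|/(congr1 (@env_val _ _ _ _))]; first by have [] := wP i.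
  rewrite env_val_aprod -map_comp (eq_map (fun i => (wP i).2)) aprod_tens.
  by move=> /tens_eq0[].
move=> g h x y /asboolP[r [rP xE]] /asboolP[s [sP yE]]; apply: val_inj.
change (tensor_mul (env_val x) (env_val y) =
  (theta g h * eta g h) *: tensor_mul (env_val y) (env_val x)).
rewrite xE yE !tensor_mul_sum [in RHS]exchange_big scaler_sumr.
apply: eq_big_seq => i ir; rewrite scaler_sumr; apply: eq_big_seq => j js /=.
have /andP[i1 i2] := allP rP _ ir; have /andP[j1 j2] := allP sP _ js.
rewrite !tensor_mul_tens (thetaA g h) // (etaB g h) //.
by rewrite (linear_Z (tens_linl _)) (linear_Z (tens_linr _)) scalerA.
Qed.

Lemma envelope_power_regular theta A n :
  regular_with theta A ->
  regular_with (fun g h => theta g h ^+ n.+1) (envelope_power A n.+1).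
Proof.
move=> regA; elim: n => [//|n IHn].
rewrite (_ : (fun g h => _) = (fun g h => theta g h * theta g h ^+ n.+1)).
  exact: envelope_regular.
by apply: funext => g; apply: funext => h; rewrite exprS.
Qed.

Lemma base_regular : #|G| = 1%N -> regular_with (fun _ _ => 1) (base_graded F G).
Proof.
move=> G1; have g1 (g : G) : g = 1%g by apply/fintype_le1P; rewrite G1.
pose one : base_graded F G := (1 : F).
split=> [g h|n g|g h a b _ _]; first exact: oner_neq0.
  exists (fun=> one); split=> [i|]; first by rewrite base_compE (g1 (g i)) eqxx.
  rewrite /codom /image_mem enum_ordSl /=.
  suff -> s : foldl amul one [seq one | i <- s : seq 'I_n.+1] = one.
    by apply/eqP/oner_neq0.
  elim: s => [//|i s IHs]; rewrite -[RHS]IHs /=.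
  by congr foldl; apply: mulr1.
by rewrite scale1r; apply: mulrC.
Qed.

End RegularGradings.

(** * Identities of envelopes *)

Theorem theorem6 (F : closedFieldType) (charF0 : [pchar F] =i pred0)
    (G : finGroupType) (abG : abelian [set: G])
    (A : gradedAlg F G) (theta : G -> G -> F) (regA : regular_with theta A)
    (B C : gradedAlg F G) :
  [/\ ((forall g h, theta g h = 1) -> Id_G (envelope A B) = Id_G B),
      (let tildeA := envelope_power A #|G|.-1 in
        regularly_graded tildeA /\
        Id_G (envelope tildeA (envelope A B)) = Id_G B)
    & (Id_G B = Id_G C <-> Id_G (envelope A B) = Id_G (envelope A C))].
Proof.
split=> [theta1||].
- apply/(Id_G_eqP _ _ charF0); split=> [|n g c]; first exact: envelope_trivial regA.
  have [L ->] := mlin_identity_envelope F g; last exact: regA.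
  by under eq_fun do rewrite swap_factor_one // mul1r.
- pose eta g h := theta g h ^+ #|G|.-1.
  set tildeA := envelope_power _ _.
  have regT : regular_with eta tildeA.
    rewrite /eta /tildeA; case cardG: #|G|.-1 => [|n].
      (* The empty power is F, whose commutation function is theta ^ 0 = 1. *)
      have G1 : #|G| = 1%N.
        move: cardG; rewrite -cardsT.
        by case: #|_| (cardG_gt0 [set: G]%G) => [|[]].
      have := base_regular F G1.
      by congr regular_with; do 2!apply: funext => ?; rewrite expr0.
    exact: envelope_power_regular.
  split; first by exists eta.
  apply/(Id_G_eqP _ _ charF0); split=> [|n g c].
    by rewrite (envelope_trivial _ regT) (envelope_trivial _ regA).
  have [L LP] := mlin_identity_envelope F g; rewrite (LP _ _ regT) (LP _ _ regA).
  have eta_theta g1 h1 : theta g1 h1 * eta g1 h1 = 1.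
    rewrite -exprS prednK ?(regular_expr_card regA) //.
    by rewrite -cardsT (cardG_gt0 [set: G]%G).
  by under eq_fun do rewrite mulrA -swap_factorM swap_factor_one // mul1r.
- have [theta_neq0 _ _] := regA.
  rewrite !(Id_G_eqP _ _ charF0) !(envelope_trivial _ regA).
  split=> -[eq0 eq_mlin]; split=> // n g c.
    by have [L LP] := mlin_identity_envelope F g; rewrite !(LP _ _ regA).
  have [L LP] := mlin_identity_envelope F g.
  have untwist W : mlin_identity W g c <-> mlin_identity (envelope A W) g
      (fun s => (swap_factor theta (L s))^-1 * c s).
    rewrite (LP _ _ regA).
    by under [in X in _ <-> X]eq_fun do rewrite mulVKf ?swap_factor_neq0 //.
  by rewrite !untwist.
Qed.
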